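(* Let $Q$ be a Hausdorff, connected, locally path-connected space, let $G$ be a $Q$-group and $M$ be a $\hat\pi_0(G)$-module. The morphism $\eta^*_G:H^0(\hat{\pi}_0(G);M)\rightarrow H^0_Q(G;M_Q)$ is an isomorphism.
   Context: A $Q$-space is a Hausdorff, locally path-connected space $X$ with a continuous map $X\to Q$, written $x\mapsto \|x\|$. A $Q$-group is a group object in $Q$-spaces (continuous multiplication $m:G\times_Q G\to G$, unit $Q\to G$ and inverse $G\to G$ over $Q$, making every fibre a group). For a discrete group $D$, $D_Q$ denotes $D\times Q\to Q$ with fibrewise law. $G^k_Q$ is the $k$-fold fibre product of $G$ over $Q$ ($G^0_Q=Q$). The group $\hat\pi_0(G)$: for $c_1,c_2\in\pi_0(G)$ let $c_1\cdot c_2$ be the set of connected components of $G$ meeting $m(c_1\times_Q c_2)$; $\hat\pi_0(G)=\langle \pi_0(G)\mid c_1c_2c_3^{-1},\ c_3\in c_1\cdot c_2\rangle$. $\eta_G:G\to\hat\pi_0(G)$ sends $g$ to the class of its connected component. If $M$ is a $\hat\pi_0(G)$-module (a discrete abelian group), $M_Q=M\times Q$ is a $G$-module via $g\cdot(m;\|g\|)=(\eta_G(g)m;\|g\|)$. Cohomology: $C^k_Q(G;M_Q)$ is the group of continuous maps over $Q$, $\alpha:G^k_Q\to M_Q$, with differential $$d\alpha(g_1;\dots;g_{k+1})=g_1\cdot\alpha(g_2;\dots;g_{k+1})+\sum_{i=1}^k(-1)^i\alpha(g_1;\dots;g_ig_{i+1};\dots;g_{k+1})+(-1)^{k+1}\alpha(g_1;\dots;g_k)$$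 (in degree $0$, a cochain is a continuous section $\alpha$ of $M_Q\to Q$ and $d\alpha(g)=g\cdot\alpha(\|g\|)-\alpha(\|g\|)$), and $H^k_Q(G;M_Q)$ is its cohomology. $\eta_G^*$ is the map in cohomology induced by pulling back ordinary group cochains of $\hat\pi_0(G)$ with values in $M$ along $\eta_G$. *)

(* Defs.v *)
From HB Require Import structures.
From mathcomp Require Import all_boot all_order all_algebra.
From mathcomp Require Import generic_quotient ring_quotient.
From mathcomp Require Import all_classical all_reals topology normedtype.
Import numFieldNormedType.Exports.

Set Implicit Arguments.
Unset Strict Implicit.
Unset Printing Implicit Defensive.

Import Order.TTheory GRing.Theory Num.Theory.
Local Open Scope classical_set_scope.
Local Open Scope ring_scope.
Local Open Scope quotient_scope.

Section Cohomology.
Variables (C : nat -> zmodType) (d : forall k, {additive C k -> C k.+1}).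

Definition cocycle_pred k : {pred C k} := fun x => d k x == 0.

Lemma cocycle_zmod_closed k : zmod_closed (@cocycle_pred k).
Proof.
split=> [|x y]; first by rewrite unfold_in /cocycle_pred raddf0.
by rewrite !unfold_in /cocycle_pred raddfB => /eqP -> /eqP ->; rewrite subrr.
Qed.

HB.instance Definition _ k :=
  GRing.isZmodClosed.Build (C k) (@cocycle_pred k) (@cocycle_zmod_closed k).

Definition cocycle k : Type := {x : C k | x \in @cocycle_pred k}.
HB.instance Definition _ k := Choice.on (cocycle k).
HB.instance Definition _ k := SubType.on (cocycle k).
HB.instance Definition _ k := [SubChoice_isSubZmodule of cocycle k by <:].

(* There are no cochains in degree -1, so that only 0 bounds in degree 0. *)
Definition coboundary_pred k : {pred cocycle k} :=
  match k return {pred cocycle k} with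
  | 0 => fun x => val x == 0
  | k'.+1 => fun x => `[< exists y : C k', val x = d k' y >]
  end.

Lemma coboundary_zmod_closed k : zmod_closed (@coboundary_pred k).
Proof.
case: k => [|k]; split=> [|x y]; rewrite !unfold_in.
- by rewrite /coboundary_pred (raddf0 \val).
- move=> /eqP xE /eqP yE.
  by rewrite /coboundary_pred (raddfB \val) /= xE yE subrr.
- by apply/asboolP; exists 0; rewrite (raddf0 \val) raddf0.
- move=> /asboolP[u uE] /asboolP[v vE]; apply/asboolP; exists (u - v).
  by rewrite (raddfB \val) raddfB /= uE vE.
Qed.

HB.instance Definition _ k := GRing.isZmodClosed.Build (cocycle k)
  (@coboundary_pred k) (@coboundary_zmod_closed k).

(* Cocycles modulo those cocycles that are coboundaries: this is the usual
   cohomology when [d] squares to zero, a fact that the definition itself does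
   not use. *)
Definition cohomology k : zmodType :=
  Quotient.quot (@coboundary_pred k : zmodClosed (cocycle k)).

Definition cohomology_class k (x : cocycle k) : cohomology k :=
  \pi_(cohomology k) x.

Lemma cohomology_class_zmod_morphism k : zmod_morphism (@cohomology_class k).
Proof.
move=> x y; apply: etrans (Quotient.pi_add (@coboundary_pred k) x (- y)) _.
exact/congr1/Quotient.pi_opp.
Qed.

HB.instance Definition _ k := GRing.isZmodMorphism.Build
  (cocycle k) (cohomology k) (@cohomology_class k)
  (@cohomology_class_zmod_morphism k).

End Cohomology.

Section InducedMap.
Variables (C C' : nat -> zmodType).
Variables (d : forall k, {additive C k -> C k.+1}).
Variables (d' : forall k, {additive C' k -> C' k.+1}).
Variables (f : forall k, {additive C k -> C' k}).
Hypothesis fd : forall k x, f k.+1 (d k x) = d' k (f k x).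

Lemma cocycle_map_subproof k (x : cocycle d k) :
  f k (val x) \in @cocycle_pred C' d' k.
Proof.
have /eqP dx : val x \in @cocycle_pred C d k := valP x.
by rewrite unfold_in /cocycle_pred -fd dx raddf0.
Qed.

Definition cocycle_map k (x : cocycle d k) : cocycle d' k :=
  Sub (f k (val x)) (cocycle_map_subproof x).

Lemma cocycle_map_zmod_morphism k : zmod_morphism (@cocycle_map k).
Proof.
move=> x y; apply: val_inj; rewrite [RHS](raddfB \val).
exact: (etrans (congr1 (f k) (raddfB \val x y)) (raddfB (f k) _ _)).
Qed.

HB.instance Definition _ k := GRing.isZmodMorphism.Build
  (cocycle d k) (cocycle d' k) (@cocycle_map k) (@cocycle_map_zmod_morphism k).

Lemma cocycle_map_coboundary k (x : cocycle d k) :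
  x \in @coboundary_pred C d k -> cocycle_map x \in @coboundary_pred C' d' k.
Proof.
case: k x => [|k] x; rewrite !unfold_in.
  by rewrite /coboundary_pred /= => /eqP ->; rewrite raddf0.
by move=> /asboolP[y yE]; apply/asboolP; exists (f k y); rewrite /= yE fd.
Qed.

Definition cohomology_map k (h : cohomology d k) : cohomology d' k :=
  cohomology_class (cocycle_map (repr h)).

Lemma cohomology_map_class k (x : cocycle d k) :
  cohomology_map (cohomology_class x) = cohomology_class (cocycle_map x).
Proof.
apply/eqP; rewrite /cohomology_map /cohomology_class -Quotient.idealrBE.
by rewrite -raddfB cocycle_map_coboundary // Quotient.idealrBE reprK.
Qed.

Lemma cohomology_map_zmod_morphism k : zmod_morphism (@cohomology_map k).
Proof.
move=> x y; rewrite -[x]reprK -[y]reprK.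
rewrite -!/(cohomology_class _) -raddfB !cohomology_map_class.
by rewrite !raddfB.
Qed.

HB.instance Definition _ k := GRing.isZmodMorphism.Build
  (cohomology d k) (cohomology d' k) (@cohomology_map k)
  (@cohomology_map_zmod_morphism k).

End InducedMap.

(* The letter [(s, false)] stands for the generator [s] and the letter
   [(s, true)] for its inverse. *)
Definition word (S : Type) := seq (S * bool).

Definition inv_word (S : Type) (w : word S) : word S :=
  rev [seq (l.1, ~~ l.2) | l <- w].

Section Presentation.
Variables (S : choiceType) (relators : set (word S)).

(* The congruence on words whose quotient is <S | relators>. *)
Inductive word_eq : word S -> word S -> Prop :=
| word_eq_refl w : word_eq w w
| word_eq_sym v w : word_eq v w -> word_eq w v
| word_eq_trans u v w : word_eq u v -> word_eq v w -> word_eq u w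
| word_eq_cat v v' w w' :
    word_eq v v' -> word_eq w w' -> word_eq (v ++ w) (v' ++ w')
| word_eq_cancel s b : word_eq [:: (s, b); (s, ~~ b)] [::]
| word_eq_relator w : relators w -> word_eq w [::].

Definition word_eqb : rel (word S) := fun v w => `[< word_eq v w >].

Lemma word_eqb_equiv : equiv_class_of word_eqb.
Proof.
split=> [w|v w|v u w]; first exact/asboolP/word_eq_refl.
  by apply/asboolP/asboolP; apply: word_eq_sym.
by move=> /asboolP uv /asboolP vw; apply/asboolP/(word_eq_trans uv).
Qed.

Canonical word_eqb_equivRel := EquivRelPack word_eqb_equiv.
Canonical word_eqb_encModRel := defaultEncModRel word_eqb.

Definition presented : Type := {eq_quot word_eqb}.
HB.instance Definition _ := Choice.on presented.
HB.instance Definition _ := EqQuotient.on presented.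

Lemma word_eqP v w : reflect (word_eq v w) (v == w %[mod presented]).
Proof. by rewrite piE; exact: asboolP. Qed.

Lemma word_eq_pi v w : word_eq v w -> \pi_presented v = \pi_presented w.
Proof. by move=> /word_eqP/eqP. Qed.

Lemma word_eq_repr w : word_eq (repr (\pi_presented w)) w.
Proof. by apply/word_eqP; rewrite reprK. Qed.

Lemma word_eq_invr w : word_eq (w ++ inv_word w) [::].
Proof.
elim: w => [|[s b] w IH]; first exact: word_eq_refl.
rewrite /inv_word /= rev_cons -cats1 catA -cat_cons -cat1s.
apply: word_eq_trans (word_eq_cancel s b).
rewrite -[X in word_eq _ X]/([:: (s, b)] ++ [:: (s, ~~ b)]) -catA.
apply: word_eq_cat; first exact: word_eq_refl.
exact: (word_eq_cat (w' := [:: _]) IH (word_eq_refl _)).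
Qed.

Lemma inv_wordK : involutive (@inv_word S).
Proof.
move=> w; rewrite /inv_word map_rev revK -map_comp -[RHS]map_id.
by apply: eq_map => -[s b] /=; rewrite negbK.
Qed.

Lemma word_eq_invl w : word_eq (inv_word w ++ w) [::].
Proof. by have := word_eq_invr (inv_word w); rewrite inv_wordK. Qed.

Lemma word_eq_inv v w : word_eq v w -> word_eq (inv_word v) (inv_word w).
Proof.
move=> vw; apply: (@word_eq_trans _ (inv_word v ++ (w ++ inv_word w))).
  rewrite -[X in word_eq X _]cats0.
  exact/word_eq_cat/word_eq_sym/word_eq_invr/word_eq_refl.
rewrite -[X in word_eq _ X]cat0s catA; apply: word_eq_cat (word_eq_refl _).
apply: word_eq_trans (word_eq_invl v).
exact/word_eq_cat/word_eq_sym/vw/word_eq_refl.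
Qed.

Definition presented_one : presented := \pi_presented [::].
Definition presented_mul (x y : presented) : presented :=
  \pi_presented (repr x ++ repr y).
Definition presented_inv (x : presented) : presented :=
  \pi_presented (inv_word (repr x)).

Lemma presented_mul_pi v w :
  presented_mul (\pi_presented v) (\pi_presented w) = \pi_presented (v ++ w).
Proof. by apply: word_eq_pi; apply: word_eq_cat; exact: word_eq_repr. Qed.

Lemma presented_inv_pi w :
  presented_inv (\pi_presented w) = \pi_presented (inv_word w).
Proof. by apply: word_eq_pi; exact/word_eq_inv/word_eq_repr. Qed.

Lemma presented_mulA : associative presented_mul.
Proof.
elim/quotW=> u; elim/quotW=> v; elim/quotW=> w.
rewrite (presented_mul_pi v w) (presented_mul_pi u v).
by rewrite (presented_mul_pi u) (presented_mul_pi _ w) catA.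
Qed.

Lemma presented_mul1g : left_id presented_one presented_mul.
Proof. by elim/quotW=> w; rewrite presented_mul_pi. Qed.

Lemma presented_mulg1 : right_id presented_one presented_mul.
Proof. by elim/quotW=> w; rewrite presented_mul_pi cats0. Qed.

Lemma presented_mulVg : left_inverse presented_one presented_inv presented_mul.
Proof.
elim/quotW=> w; rewrite presented_inv_pi presented_mul_pi.
by apply: word_eq_pi; exact: word_eq_invl.
Qed.

Lemma presented_mulgV : right_inverse presented_one presented_inv presented_mul.
Proof.
elim/quotW=> w; rewrite presented_inv_pi presented_mul_pi.
by apply: word_eq_pi; exact: word_eq_invr.
Qed.

HB.instance Definition _ := isGroup.Build presented presented_mulA
  presented_mul1g presented_mulg1 presented_mulVg presented_mulgV.

Definition generator (s : S) : presented := \pi_presented [:: (s, false)].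

End Presentation.

Record gmodule (pi : groupType) := GModule {
  gmodule_zmod :> zmodType;
  gact : pi -> gmodule_zmod -> gmodule_zmod;
  gact1 : forall m, gact 1%g m = m;
  gactM : forall x y m, gact (x * y)%g m = gact x (gact y m);
  gactD : forall x m n, gact x (m + n) = gact x m + gact x n
}.

Section GmoduleTheory.
Variables (pi : groupType) (M : gmodule pi).

Lemma gact_zmod_morphism x : zmod_morphism (@gact pi M x).
Proof.
move=> m n; apply: (addIr (gact x n)).
by rewrite -gactD !subrK.
Qed.

HB.instance Definition _ x := GRing.isZmodMorphism.Build M M (@gact pi M x)
  (gact_zmod_morphism x).

End GmoduleTheory.

(* With indices starting at 0, [merge_at i a g] is
   [(g_0, ..., g_(i-1), a, g_(i+2), ..., g_k)]. *)
Definition merge_at (A : Type) k (i : 'I_k) (a : A) (g : 'I_k.+1 -> A) :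
    'I_k -> A :=
  fun j => if (j < i)%N then g (lift ord_max j)
           else if j == i then a else g (lift ord0 j).

Lemma subr_add3 (V : zmodType) (a b c a' b' c' : V) :
  (a - a') + (b - b') + (c - c') = (a + b + c) - (a' + b' + c').
Proof. by rewrite (opprD (a' + b')) opprD (addrACA a) (addrACA (a + b)). Qed.

Section GroupCohomology.
Variables (pi : groupType) (M : gmodule pi).

Definition group_cochain k : zmodType := ('I_k -> pi) -> M.

Definition group_diff k (c : group_cochain k) : group_cochain k.+1 := fun g =>
  gact (g ord0) (c (g \o lift ord0))
  + \sum_(i < k) c (merge_at i (g (lift ord_max i) * g (lift ord0 i))%g g)
      *~ (-1) ^+ i.+1
  + c (g \o lift ord_max) *~ (-1) ^+ k.+1.

Lemma group_diff_zmod_morphism k : zmod_morphism (@group_diff k).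
Proof.
have fB j (u v : group_cochain j) x : (u - v) x = u x - v x by [].
move=> a b; apply/funext => g; rewrite fB /group_diff !fB.
apply: etrans (subr_add3 _ _ _ _ _ _); congr (_ + _ + _).
- exact: raddfB (gact (g ord0)) _ _.
- by rewrite -sumrB; apply: eq_bigr => i _; rewrite -mulrzBl.
- by rewrite -mulrzBl.
Qed.

HB.instance Definition _ k := GRing.isZmodMorphism.Build
  (group_cochain k) (group_cochain k.+1) (@group_diff k)
  (@group_diff_zmod_morphism k).

Definition group_cohomology k : zmodType :=
  cohomology (fun k => @group_diff k : {additive _ -> _}) k.

End GroupCohomology.

(* The real numbers are any [R : realType], and paths are functions on R that
   are continuous on [0, 1]. *)
Definition path_connected (R : realType) (T : topologicalType) (A : set T) :=
  forall x y, A x -> A y -> exists f : R -> T,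
    [/\ {within `[0, 1]%classic, continuous f}, f 0 = x, f 1 = y
      & f @` `[0, 1]%classic `<=` A].

Definition locally_path_connected (R : realType) (T : topologicalType) :=
  forall (x : T) (U : set T), nbhs x U ->
    exists V : set T, [/\ open V, V x, V `<=` U & path_connected R V].

Section QSpaces.
Variables (R : realType) (Q : topologicalType).

Record qspace := QSpace {
  qspace_top :> topologicalType;
  qnorm : qspace_top -> Q;
  qnorm_continuous : continuous qnorm;
  qspace_hausdorff : hausdorff_space qspace_top;
  qspace_lpc : locally_path_connected R qspace_top
}.

(* Subsets of spaces are turned into spaces by the coercion [set_type], and
   these carry the subspace topology. *)
Definition fib_prod (X : qspace) : set (X * X) :=
  [set xy | qnorm xy.1 = qnorm xy.2].
Arguments fib_prod : clear implicits.

Definition fib_pair (X : qspace) (x y : X) (xy : qnorm x = qnorm y) :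
  fib_prod X := SigSub (mem_set xy : (x, y) \in fib_prod X).

(* Group axioms on the fibres; since [qmul] is only defined on pairs lying in
   a common fibre, the axioms quantify over the proofs that it is applicable
   (such proofs always exist, by [qmul_norm], [qone_norm] and [qinv_norm]). *)
Record qgroup := QGroup {
  qgroup_space :> qspace;
  qmul : fib_prod qgroup_space -> qgroup_space;
  qone : Q -> qgroup_space;
  qinv : qgroup_space -> qgroup_space;
  qmul_continuous : continuous qmul;
  qone_continuous : continuous qone;
  qinv_continuous : continuous qinv;
  qmul_norm : forall x y (xy : qnorm x = qnorm y),
    qnorm (qmul (fib_pair xy)) = qnorm x;
  qone_norm : forall q, qnorm (qone q) = q;
  qinv_norm : forall x, qnorm (qinv x) = qnorm x;
  qmulA : forall x y z (xy : qnorm x = qnorm y) (yz : qnorm y = qnorm z)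
    (x_yz : qnorm x = qnorm (qmul (fib_pair yz)))
    (xy_z : qnorm (qmul (fib_pair xy)) = qnorm z),
    qmul (fib_pair x_yz) = qmul (fib_pair xy_z);
  qmul1g : forall x (e : qnorm (qone (qnorm x)) = qnorm x),
    qmul (fib_pair e) = x;
  qmulg1 : forall x (e : qnorm x = qnorm (qone (qnorm x))),
    qmul (fib_pair e) = x;
  qmulVg : forall x (e : qnorm (qinv x) = qnorm x),
    qmul (fib_pair e) = qone (qnorm x);
  qmulgV : forall x (e : qnorm x = qnorm (qinv x)),
    qmul (fib_pair e) = qone (qnorm x)
}.

Section HatPi0.
Variable G : qgroup.

Definition pi0 : Type := range (connected_component [set: G]).
HB.instance Definition _ := Choice.on pi0.

Definition component_set (c : pi0) : set G := val c.

Definition component_of (g : G) : pi0 :=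
  SigSub (mem_set (imageT (connected_component [set: G]) g)).

Definition pi0_mul (c1 c2 : pi0) : set pi0 :=
  [set c3 | exists g1 g2 (g12 : qnorm g1 = qnorm g2),
    [/\ component_set c1 g1, component_set c2 g2
      & component_set c3 (qmul (fib_pair g12))]].

Definition pi0_relators : set (word pi0) :=
  [set w | exists c1 c2 c3,
    pi0_mul c1 c2 c3 /\ w = [:: (c1, false); (c2, false); (c3, true)]].

Definition hat_pi0 : groupType := presented pi0_relators.

Definition etaG (g : G) : hat_pi0 := generator pi0_relators (component_of g).

Lemma path_connectedW (A : set G) : path_connected R A -> connected A.
Proof.
move=> pA; have [->|/set0P[x Ax]] := eqVneq A set0; first exact: connected0.
have -> : A = connected_component A x.
  apply/seteqP; split; last exact: connected_component_sub.
  move=> y Ay; have [f [cf fx fy fA]] := pA x y Ax Ay.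
  exists (f @` `[0, 1]%classic); last by exists 1; rewrite //= in_itv/= ler01 lexx.
  split=> //; first by exists 0; rewrite //= in_itv/= ler01 lexx.
  apply: connected_continuous_connected => //; exact: segment_connected.
exact: component_connected.
Qed.

Lemma component_of_near (g : G) :
  \forall h \near g, component_of h = component_of g.
Proof.
have [V [oV Vg _ /path_connectedW cV]] := @qspace_lpc G g setT filterT.
apply: (filterS _ (open_nbhs_nbhs (conj oV Vg))) => h Vh.
apply: val_inj => /=; apply/esym/same_connected_component.
by exists V.
Qed.

Lemma eta_near (g : G) : \forall h \near g, etaG h = etaG g.
Proof. by apply: filterS (component_of_near g) => h hg; rewrite /etaG hg. Qed.

Lemma component_of_self (g : G) : component_set (component_of g) g.
Proof. exact: connected_component_refl. Qed.

Lemma eta_mul (x y : G) (xy : qnorm x = qnorm y) :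
  etaG (qmul (fib_pair xy)) = (etaG x * etaG y)%g.
Proof.
set z := qmul _; rewrite [RHS]presented_mul_pi.
apply: word_eq_pi; apply: word_eq_sym => /=.
have rel : word_eq pi0_relators [:: (component_of x, false);
    (component_of y, false); (component_of z, true)] [::].
  apply: word_eq_relator; exists (component_of x), (component_of y).
  exists (component_of z); split=> //; exists x, y, xy.
  by split; exact: component_of_self.
have czz := word_eq_sym (word_eq_cancel pi0_relators (component_of z) true).
apply: word_eq_trans
  (word_eq_cat rel (word_eq_refl _ [:: (component_of z, false)])).
exact: (word_eq_cat (word_eq_refl _ [:: (_, _); (_, _)]) czz).
Qed.

End HatPi0.
End QSpaces.
Arguments fib_prod {R Q} X.
Arguments hat_pi0 {R Q} G.

Section QCohomology.
Variables (R : realType) (Q : topologicalType) (G : qgroup R Q).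

(* The k-fold fibre product over Q; a point carries its image in Q, so that
   the 0-fold product is Q. *)
Definition fib_pow k : set (Q * {ptws 'I_k -> G}) :=
  [set x | forall i, qnorm (x.2 i) = x.1].
Arguments fib_pow : clear implicits.

Definition fib_base k (x : fib_pow k) : Q := (val x).1.
Definition fib_coord k (x : fib_pow k) : 'I_k -> G := (val x).2.

Lemma fib_coord_norm k (x : fib_pow k) i : qnorm (fib_coord x i) = fib_base x.
Proof. exact: set_valP x i. Qed.

Lemma fib_coord_eq k (x : fib_pow k) i j :
  qnorm (fib_coord x i) = qnorm (fib_coord x j).
Proof. by rewrite !fib_coord_norm. Qed.

Definition fib_point k (q : Q) (g : 'I_k -> G) (gq : forall i, qnorm (g i) = q) :
  fib_pow k := SigSub (mem_set gq : (q, g) \in fib_pow k).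

Lemma face_first_subproof k (x : fib_pow k.+1) i :
  qnorm ((fib_coord x \o lift ord0) i) = fib_base x.
Proof. exact: fib_coord_norm. Qed.

Definition face_first k (x : fib_pow k.+1) : fib_pow k :=
  fib_point (face_first_subproof x).

Lemma face_last_subproof k (x : fib_pow k.+1) i :
  qnorm ((fib_coord x \o lift ord_max) i) = fib_base x.
Proof. exact: fib_coord_norm. Qed.

Definition face_last k (x : fib_pow k.+1) : fib_pow k :=
  fib_point (face_last_subproof x).

Definition fib_coord_mul k (i : 'I_k) (x : fib_pow k.+1) : G :=
  qmul (fib_pair (fib_coord_eq x (lift ord_max i) (lift ord0 i))).

Lemma face_mid_subproof k (i : 'I_k) (x : fib_pow k.+1) j :
  qnorm (merge_at i (fib_coord_mul i x) (fib_coord x) j) = fib_base x.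
Proof.
rewrite /merge_at; case: ifP => _; first exact: fib_coord_norm.
by case: ifP => _; rewrite ?qmul_norm fib_coord_norm.
Qed.

Definition face_mid k (i : 'I_k) (x : fib_pow k.+1) : fib_pow k :=
  fib_point (face_mid_subproof i x).

Lemma fib_base_continuous k : continuous (@fib_base k).
Proof.
move=> x; apply: continuous_comp; first exact: initial_continuous.
exact: cvg_fst.
Qed.

Lemma fib_coord_continuous k i : continuous (fun x : fib_pow k => fib_coord x i).
Proof.
have c2 : continuous (fun x : fib_pow k => (val x).2 : {ptws 'I_k -> G}).
  move=> x; apply: continuous_comp; first exact: initial_continuous.
  exact: cvg_snd.
move=> x; have p := @proj_continuous _ (fun _ : 'I_k => G) i (val x).2.
exact: (continuous_comp (c2 x) p).
Qed.

Lemma ptws_continuous (X T : topologicalType) (I : Type)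
    (f : X -> {ptws I -> T}) :
  (forall i, continuous (fun x => f x i)) -> continuous f.
Proof.
move=> fc x; apply/cvg_sup => i U [/= _ [[W oW <-] Wfx WU]].
by apply: (filterS WU); apply: (fc i x); exact: open_nbhs_nbhs.
Qed.

Lemma fib_point_continuous (X : topologicalType) k (f : X -> fib_pow k) :
    continuous (fun x => fib_base (f x)) ->
    (forall i, continuous (fun x => fib_coord (f x) i)) ->
  continuous f.
Proof.
move=> fb fc; apply: continuous_comp_initial => x.
have -> : set_val \o f = fun x => (fib_base (f x), (val (f x)).2).
  by apply/funext => y; rewrite /= set_valE; exact: surjective_pairing.
have f2 : continuous (fun x => (val (f x)).2 : {ptws 'I_k -> G}).
  exact: ptws_continuous.
exact: cvg_pair (fb x) (f2 x).
Qed.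

Lemma face_first_continuous k : continuous (@face_first k).
Proof.
apply: fib_point_continuous => [|i]; first exact: fib_base_continuous.
exact: (@fib_coord_continuous k.+1 (lift ord0 i)).
Qed.

Lemma face_last_continuous k : continuous (@face_last k).
Proof.
apply: fib_point_continuous => [|i]; first exact: fib_base_continuous.
exact: (@fib_coord_continuous k.+1 (lift ord_max i)).
Qed.

Lemma fib_coord_mul_continuous k i : continuous (@fib_coord_mul k i).
Proof.
move=> x; apply: continuous_comp; last exact: qmul_continuous.
move: x; apply: continuous_comp_initial => x.
exact: cvg_pair (@fib_coord_continuous k.+1 (lift ord_max i) x)
                (@fib_coord_continuous k.+1 (lift ord0 i) x).
Qed.

Lemma face_mid_continuous k (i : 'I_k) : continuous (face_mid i).
Proof.
apply: fib_point_continuous => [|j]; first exact: fib_base_continuous.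
suff: continuous (fun x : fib_pow k.+1 =>
  merge_at i (fib_coord_mul i x) (fib_coord x) j) by exact.
rewrite /merge_at; case: (j < i)%N.
  exact: (@fib_coord_continuous k.+1 (lift ord_max j)).
case: (j == i); first exact: fib_coord_mul_continuous.
exact: (@fib_coord_continuous k.+1 (lift ord0 j)).
Qed.

Variable M : gmodule (hat_pi0 G).

Definition qmodule : topologicalType := (discrete_topology M * Q)%type.

(* Only meaningful when the second component of [y] is the norm of [g]. *)
Definition qmodule_act (g : G) (y : qmodule) : qmodule :=
  (gact (etaG g) y.1, qnorm g).

Definition qcochain_set k : set (fib_pow k -> qmodule) :=
  [set a | continuous a /\ forall x, (a x).2 = fib_base x].
Arguments qcochain_set : clear implicits.

Definition qcochain k : Type := qcochain_set k.
HB.instance Definition _ k := Choice.on (qcochain k).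
HB.instance Definition _ k := SubType.on (qcochain k).

(* A cochain is determined by its M-component, as its Q-component is forced;
   a function to M is such a component iff it is locally constant. *)
Definition qvalue k (a : qcochain k) (x : fib_pow k) : M := (val a x).1.

Lemma qcochain_continuousP k (f : fib_pow k -> M) :
  continuous (fun x => (f x, fib_base x) : qmodule) <->
  forall x, \forall y \near x, f y = f x.
Proof.
pose f' (x : fib_pow k) : discrete_topology M := f x.
split=> [cf x|cf x].
  have cf' : f' @ x --> f' x by exact: cvg_comp (cf x) cvg_fst.
  exact: cf' _ (discrete_set1 (f' x)).
have cf' : f' @ x --> f' x.
  move=> U nU; have Ufx : U (f x) by exact: (@nbhs_singleton _ (f' x) U nU).
  by apply: filterS (cf x) => y /= fyx; rewrite /f' /= fyx.
exact: cvg_pair cf' (@fib_base_continuous k x).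
Qed.

Lemma qvalue_near k (a : qcochain k) x :
  \forall y \near x, qvalue a y = qvalue a x.
Proof.
have [ca a2] := set_valP a; apply/qcochain_continuousP: x => //.
have -> : (fun x => (qvalue a x, fib_base x) : qmodule) = val a; last exact: ca.
by apply/funext => y; rewrite -a2 -surjective_pairing.
Qed.

Lemma qvalue_inj k (a b : qcochain k) : qvalue a =1 qvalue b -> a = b.
Proof.
move=> ab; apply: val_inj; apply/funext => x.
have [[_ a2] [_ b2]] := (set_valP a, set_valP b).
rewrite [LHS]surjective_pairing [RHS]surjective_pairing.
by congr pair; [exact: ab|rewrite a2 b2].
Qed.

Lemma qcochain_of_subproof k (f : fib_pow k -> M)
    (fn : forall x, \forall y \near x, f y = f x) :
  (fun x => (f x, fib_base x)) \in qcochain_set k.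
Proof. by apply: mem_set; split=> //; apply/qcochain_continuousP. Qed.

Definition qcochain_of k (f : fib_pow k -> M)
    (fn : forall x, \forall y \near x, f y = f x) : qcochain k :=
  SigSub (qcochain_of_subproof fn).

Lemma qcochain_zero_subproof k (x : fib_pow k) :
  \forall y \near x, (0 : M) = 0.
Proof. by apply: filterE. Qed.

Lemma qcochain_opp_subproof k (a : qcochain k) x :
  \forall y \near x, - qvalue a y = - qvalue a x.
Proof. by apply: filterS (qvalue_near a x) => y ->. Qed.

Lemma qcochain_add_subproof k (a b : qcochain k) x :
  \forall y \near x, qvalue a y + qvalue b y = qvalue a x + qvalue b x.
Proof. by apply: filterS2 (qvalue_near a x) (qvalue_near b x) => y -> ->. Qed.

Definition qcochain_zero k : qcochain k :=
  qcochain_of (@qcochain_zero_subproof k).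
Definition qcochain_opp k (a : qcochain k) : qcochain k :=
  qcochain_of (qcochain_opp_subproof a).
Definition qcochain_add k (a b : qcochain k) : qcochain k :=
  qcochain_of (qcochain_add_subproof a b).

Lemma qcochain_addA k : associative (@qcochain_add k).
Proof. by move=> a b c; apply: qvalue_inj => x; exact: addrA. Qed.

Lemma qcochain_addC k : commutative (@qcochain_add k).
Proof. by move=> a b; apply: qvalue_inj => x; exact: addrC. Qed.

Lemma qcochain_add0 k : left_id (@qcochain_zero k) (@qcochain_add k).
Proof. by move=> a; apply: qvalue_inj => x; exact: add0r. Qed.

Lemma qcochain_addN k :
  left_inverse (@qcochain_zero k) (@qcochain_opp k) (@qcochain_add k).
Proof. by move=> a; apply: qvalue_inj => x; exact: addNr. Qed.

HB.instance Definition _ k := GRing.isZmodule.Build (qcochain k)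
  (@qcochain_addA k) (@qcochain_addC k) (@qcochain_add0 k) (@qcochain_addN k).

Lemma qvalueB k (a b : qcochain k) x :
  qvalue (a - b) x = qvalue a x - qvalue b x.
Proof. by []. Qed.

Definition qdiff_fun k (a : qcochain k) (x : fib_pow k.+1) : M :=
  (qmodule_act (fib_coord x ord0) (val a (face_first x))).1
  + \sum_(i < k) qvalue a (face_mid i x) *~ (-1) ^+ i.+1
  + qvalue a (face_last x) *~ (-1) ^+ k.+1.

Lemma qdiff_subproof k (a : qcochain k) x :
  \forall y \near x, qdiff_fun a y = qdiff_fun a x.
Proof.
have n1 := face_first_continuous (qvalue_near a (face_first x)).
have n2 := face_last_continuous (qvalue_near a (face_last x)).
have n3 : \forall y \near x, forall i : 'I_k,
    qvalue a (face_mid i y) = qvalue a (face_mid i x).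
  have n i := face_mid_continuous (qvalue_near a (face_mid i x)).
  exact: (@filter_forall _ _ (fun i y => qvalue a (face_mid i y) =
    qvalue a (face_mid i x)) (nbhs x) _ n).
have n4 := @fib_coord_continuous k.+1 ord0 x _ (eta_near (fib_coord x ord0)).
near=> y.
have e1 : qvalue a (face_first y) = qvalue a (face_first x) by near: y.
have e2 : qvalue a (face_last y) = qvalue a (face_last x) by near: y.
have e3 : forall i : 'I_k, qvalue a (face_mid i y) = qvalue a (face_mid i x).
  by near: y.
have e4 : etaG (fib_coord y ord0) = etaG (fib_coord x ord0) by near: y.
rewrite /qdiff_fun /qmodule_act /= -!/(qvalue _ _) e1 e2 e4.
by under eq_bigr => i _ do rewrite e3.
Unshelve. all: by end_near.
Qed.

Definition qdiff k (a : qcochain k) : qcochain k.+1 :=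
  qcochain_of (qdiff_subproof a).

Lemma qdiff_zmod_morphism k : zmod_morphism (@qdiff k).
Proof.
move=> a b; apply: qvalue_inj => x; rewrite qvalueB.
apply: etrans (subr_add3 _ _ _ _ _ _); congr (_ + _ + _).
- exact: raddfB (gact (etaG (fib_coord x ord0))) _ _.
- by rewrite -sumrB; apply: eq_bigr => i _; rewrite -mulrzBl.
- by rewrite -mulrzBl.
Qed.

HB.instance Definition _ k := GRing.isZmodMorphism.Build
  (qcochain k) (qcochain k.+1) (@qdiff k) (@qdiff_zmod_morphism k).

Definition qcohomology k : zmodType :=
  cohomology (fun k => @qdiff k : {additive _ -> _}) k.

Lemma eta_pullback_subproof k (c : group_cochain M k) x :
  \forall y \near x,
    c (@etaG R Q G \o fib_coord y) = c (@etaG R Q G \o fib_coord x).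
Proof.
have : \forall y \near x, forall i : 'I_k,
    etaG (fib_coord y i) = etaG (fib_coord x i).
  have n i := @fib_coord_continuous k i x _ (eta_near (fib_coord x i)).
  exact: (@filter_forall _ _ (fun i y => etaG (fib_coord y i) =
    etaG (fib_coord x i)) (nbhs x) _ n).
by apply: filterS => y yx; congr c; apply/funext.
Qed.

Definition eta_pullback k (c : group_cochain M k) : qcochain k :=
  qcochain_of (eta_pullback_subproof c).

Lemma eta_pullback_zmod_morphism k : zmod_morphism (@eta_pullback k).
Proof. by move=> c c'; exact: qvalue_inj. Qed.

HB.instance Definition _ k := GRing.isZmodMorphism.Build
  (group_cochain M k) (qcochain k) (@eta_pullback k)
  (@eta_pullback_zmod_morphism k).

Lemma eta_pullback_diff k (c : group_cochain M k) :
  eta_pullback (group_diff c) = qdiff (eta_pullback c).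
Proof.
apply: qvalue_inj => x; congr (_ + _ + _); apply: eq_bigr => i _.
congr (c _ *~ _); apply/funext => j; rewrite /merge_at /=.
rewrite /fib_coord /= /merge_at; case: ifP => // _; case: ifP => // _.
exact/esym/eta_mul.
Qed.

Definition eta_star k : {additive group_cohomology M k -> qcohomology k} :=
  @cohomology_map _ _ (fun k => @group_diff _ M k : {additive _ -> _})
    (fun k => @qdiff k : {additive _ -> _})
    (fun k => @eta_pullback k : {additive _ -> _}) eta_pullback_diff k.

End QCohomology.
Arguments fib_pow {R Q} G k.
Arguments qcochain_set {R Q G} M k.

(* Main.v *)
Require Import Defs.
From mathcomp Require Import all_boot all_order all_algebra.
From mathcomp Require Import all_classical all_reals topology.
From mathcomp Require Import generic_quotient ring_quotient.
Local Open Scope classical_set_scope.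

Set Implicit Arguments.
Unset Strict Implicit.
Unset Printing Implicit Defensive.

(** Nothing bounds in degree 0, so the zeroth cohomology groups are the groups
    of 0-cocycles, and the claim is that pulling back along eta_G is bijective
    on those (lemma [cohomology_map0_bij]).  An ordinary 0-cocycle is an element
    of M fixed by the group.  A 0-cocycle over Q is a locally constant function
    Q -> M, hence a single element m since Q is connected
    ([connected_locally_constant]); the cocycle condition says that eta_G(g)
    fixes m for every g in G.  Every component of G contains some g, so m is
    fixed by the generators of the group, and therefore by the whole group
    ([gact_generators]).  As Q is nonempty, m is recovered by evaluating at any
    point of Q, which is the inverse of the pullback
    ([eta_cocycle_map0_bij]). *)

Import GRing.Theory.
Local Open Scope ring_scope.
Local Open Scope quotient_scope.

Section DegreeZero.
Variables (C : nat -> zmodType) (d : forall k, {additive C k -> C k.+1}).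

(** The only 0-cochain that bounds is 0, so a class has a single
    representative, namely the one chosen by [repr]. *)
Lemma cohomology_class0_bij : bijective (@cohomology_class C d 0).
Proof.
exists repr => [x|h]; last exact: reprK.
have : cohomology_class (repr (cohomology_class x)) = cohomology_class x.
  exact: reprK.
move/eqP; rewrite /cohomology_class -Quotient.idealrBE unfold_in.
rewrite /coboundary_pred (raddfB \val) /= subr_eq0 => /eqP.
exact: val_inj.
Qed.

End DegreeZero.

Lemma cohomology_map0_bij (C C' : nat -> zmodType)
    (d : forall k, {additive C k -> C k.+1})
    (d' : forall k, {additive C' k -> C' k.+1})
    (f : forall k, {additive C k -> C' k})
    (fd : forall k x, f k.+1 (d k x) = d' k (f k x)) :
  bijective (@cocycle_map C C' d d' f fd 0) ->
  bijective (@cohomology_map C C' d d' f fd 0).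
Proof.
move=> bf; have [r rK Kr] := cohomology_class0_bij d.
apply: (@eq_bij _ _ (@cohomology_class C' d' 0 \o
                     @cocycle_map C C' d d' f fd 0 \o r)).
  apply: bij_comp; last by exists (@cohomology_class C d 0).
  by apply: bij_comp => //; exact: cohomology_class0_bij.
by move=> h /=; rewrite -cohomology_map_class Kr.
Qed.

Section Generators.
Variables (S : choiceType) (relators : set (word S)).

Lemma presented_cons s b (w : word S) :
  \pi_(presented relators) ((s, b) :: w) =
  ((if b then (generator relators s)^-1 else generator relators s)
     * \pi_(presented relators) w)%g.
Proof.
rewrite -cat1s -presented_mul_pi; congr (_ * _)%g.
by case: b => //; rewrite [RHS]presented_inv_pi.
Qed.

(** The stabiliser of m is a subgroup, so it is everything as soon as it
    contains the generators; the induction is over words. *)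
Lemma gact_generators (M : gmodule (presented relators)) (m : M) :
  (forall s, gact (generator relators s) m = m) -> forall x, gact x m = m.
Proof.
move=> mS; elim/quotW; elim=> [|[s b] w IH]; first exact: gact1.
rewrite presented_cons gactM IH; case: b; last exact: mS.
by have {1}<- := mS s; rewrite -gactM mulVg gact1.
Qed.

End Generators.

(** The fibre of f through x is open, and so is its complement, so by
    connectedness the fibre is everything. *)
Lemma connected_locally_constant (T : topologicalType) (V : Type) (f : T -> V) :
  connected [set: T] -> (forall x, \forall y \near x, f y = f x) ->
  forall x y, f x = f y.
Proof.
move=> cT fn x y; pose B := [set z | f z = f x].
have oB : open B.
  by rewrite openE => z Bz; apply: filterS (fn z) => t; rewrite /B /= => ->.
have cB : closed B.
  rewrite -openC openE => z Bz.
  by apply: filterS (fn z) => t; rewrite /B /= => ->.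
have : B = setT.
  apply: cT; first by exists x.
  - by exists B => //; rewrite setTI.
  - by exists B => //; rewrite setTI.
by move=> BT; have : B y by rewrite BT.
Qed.

Lemma group_diff0E (pi : groupType) (M : gmodule pi) (c : group_cochain M 0)
    (g : 'I_1 -> pi) (h : 'I_0 -> pi) :
  group_diff c g = gact (g ord0) (c h) - c h.
Proof.
have hE (h' : 'I_0 -> pi) : h' = h by apply/funext => -[].
rewrite /group_diff big_ord0 addr0 expr1 mulrN1z.
by rewrite (hE (g \o lift ord0)).
Qed.

Section DegreeZeroCochains.
Variables (R : realType) (Q : topologicalType) (G : qgroup R Q).
Variable (M : gmodule (hat_pi0 G)).

Lemma qdiff0E (a : qcochain M 0) (x : fib_pow G 1) :
  qvalue (qdiff a) x =
  gact (etaG (fib_coord x ord0)) (qvalue a (face_first x))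
    - qvalue a (face_last x).
Proof.
rewrite [LHS]/(qdiff_fun a x) /qdiff_fun big_ord0 addr0 expr1 mulrN1z.
by [].
Qed.

(** A point of the 0-fold product still needs a family of elements of G over
    it, indexed by the empty type; the unit section supplies one. *)
Definition fib_pow0_point (q : Q) : fib_pow G 0 :=
  fib_point (fun _ : 'I_0 => qone_norm G q).

Lemma fib_pow0_point_continuous : continuous fib_pow0_point.
Proof. by apply: fib_point_continuous => [|[]//] x; exact: cvg_id. Qed.

Lemma fib_pow0_pointK x : fib_pow0_point (fib_base x) = x.
Proof.
apply: val_inj; rewrite [RHS]surjective_pairing; congr pair.
by apply/funext => -[].
Qed.

(** Seen through [fib_pow0_point], a 0-cochain is a locally constant function
    on Q. *)
Lemma qvalue0_const (a : qcochain M 0) :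
  connected [set: Q] -> forall x y, qvalue a x = qvalue a y.
Proof.
move=> cQ x y; rewrite -[x]fib_pow0_pointK -[y]fib_pow0_pointK.
pose f q := qvalue a (fib_pow0_point q).
apply: (connected_locally_constant (f := f)) => // q.
exact: fib_pow0_point_continuous (qvalue_near a (fib_pow0_point q)).
Qed.

(** A generator of the group is a component of G, hence eta_G(g) for any of its
    points g, and the cocycle condition at g says that eta_G(g) fixes the
    constant value of the cochain. *)
Lemma qcocycle0_fixed (a : qcochain M 0) :
  connected [set: Q] -> qdiff a = 0 ->
  forall x t, gact t (qvalue a x) = qvalue a x.
Proof.
move=> cQ da0 x; apply: gact_generators => c.
have [g cE] : exists g, c = component_of g.
  have [g _ gE] := set_valP c.
  by exists g; apply: val_inj; rewrite /= gE.
(* Over a 1-tuple both outer faces only remember the base point, where the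
   cochain has the same value as at x. *)
pose y : fib_pow G 1 := fib_point (g := fun=> g) (fun=> erefl (qnorm g)).
have := qdiff0E a y; rewrite da0 => /esym/eqP; rewrite subr_eq0 => /eqP.
by rewrite cE !(qvalue0_const a cQ _ x).
Qed.

Local Notation dG := (fun k => @group_diff _ M k : {additive _ -> _}).
Local Notation dQ := (fun k => @qdiff R Q G M k : {additive _ -> _}).

(** The inverse sends a cocycle to its value at a chosen point of Q; the value
    is fixed by the group, so it is an ordinary cocycle. *)
Lemma eta_cocycle_map0_bij : [set: Q] !=set0 -> connected [set: Q] ->
  bijective (@cocycle_map _ _ dG dQ
    (fun k => @eta_pullback R Q G M k : {additive _ -> _})
    (@eta_pullback_diff R Q G M) 0).
Proof.
move=> [q _] cQ; pose x := fib_pow0_point q.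
have cocP (a : cocycle dQ 0) :
    ((fun=> qvalue (val a) x) : group_cochain M 0) \in @cocycle_pred _ dG 0.
  have /eqP da0 : val a \in @cocycle_pred _ dQ 0 by exact: valP.
  apply/eqP/funext => g.
  have := @group_diff0E _ M (fun=> qvalue (val a) x) g (fun=> 1%g).
  by rewrite qcocycle0_fixed // subrr.
exists (fun a => Sub (fun=> qvalue (val a) x) (cocP a) : cocycle dG 0) => [c|a];
  apply: val_inj.
- apply/funext => t.
  by congr (val c _); apply/funext => -[].
- by apply: qvalue_inj => y; exact: (qvalue0_const (val a) cQ x y).
Qed.

End DegreeZeroCochains.

Theorem lemma1p27 (R : realType) (Q : topologicalType)
    (Q_hausdorff : hausdorff_space Q)
    (Q_nonempty : [set: Q] !=set0) (Q_connected : connected [set: Q])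
    (Q_lpc : locally_path_connected R Q)
    (G : qgroup R Q) (M : gmodule (hat_pi0 G)) :
  bijective (eta_star M 0 : group_cohomology M 0 -> qcohomology M 0).
Proof. exact/cohomology_map0_bij/eta_cocycle_map0_bij. Qed.
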